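(* Let $A$, $B$, $C$ be arbitrary $L$-algebras over a field $k$, and let $B*C$ be the free product of $B$ and $C$. If $|k|\le\dim_k(B*C)$ and $|A|\le|B*C|$, then $A$, $B$, $C$ can be embedded into a simple $L$-algebra generated by $B$ and $C$.
   Context: An $L$-algebra over $k$ is a $k$-vector space $L$ with two bilinear operations $\prec,\succ:L\times L\to L$ satisfying $(x\succ y)\prec z=x\succ(y\prec z)$ for all $x,y,z\in L$. Homomorphisms are linear maps preserving both operations; an embedding is an injective homomorphism. An ideal is a subspace $I$ with $a\prec f,\ f\prec a,\ a\succ f,\ f\succ a\in I$ for all $f\in I$, $a\in L$. An $L$-algebra is simple if its only ideals are $0$ and itself. The free product $B*C$ is an $L$-algebra with homomorphisms $\varepsilon_1:B\to B*C$ and $\varepsilon_2:C\to B*C$ such that for any $L$-algebra $L$ and homomorphisms $f_1:B\to L$, $f_2:C\to L$ there is a unique homomorphism $f:B*C\to L$ with $f\varepsilon_1=f_1$ and $f\varepsilon_2=f_2$ (i.e. the coproduct in the category of $L$-algebras over $k$). ''Generated by $B$ and $C$'' means generated as an $L$-algebra by the images of $B$ and $C$ under their embeddings. $|\cdot|$ denotes cardinality.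
   Formalization: B and C are assumed nonzero; with B = 0 the claim is false: for k = F_2 and A = C = F_2^2 with zero operations, B*C = C meets both bounds, but an L-algebra generated by B and C is then C itself, which is not simple. *)

(* Defs.v *)
From HB Require Import structures.
From mathcomp Require Import all_boot all_order all_algebra.
From mathcomp Require Import boolp classical_sets functions cardinality.

Set Implicit Arguments.
Unset Strict Implicit.
Unset Printing Implicit Defensive.

Import GRing.Theory.

Local Open Scope classical_set_scope.
Local Open Scope card_scope.
Local Open Scope ring_scope.

HB.mixin Record Lmodule_isLAlgebra (k : fieldType) V of GRing.Lmodule k V := {
  lprec : V -> V -> V;
  lsucc : V -> V -> V;
  lprec_linearl : forall z, linear (fun x => lprec x z);
  lprec_linearr : forall x, linear (lprec x);
  lsucc_linearl : forall z, linear (fun x => lsucc x z);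
  lsucc_linearr : forall x, linear (lsucc x);
  lsucc_lprecA : forall x y z, lprec (lsucc x y) z = lsucc x (lprec y z)
}.

#[short(type="lAlgebraType")]
HB.structure Definition LAlgebra (k : fieldType) :=
  { V of Lmodule_isLAlgebra k V & GRing.Lmodule k V }.

Notation "x ≺ y" := (lprec x y) (at level 40, left associativity) : ring_scope.
Notation "x ≻ y" := (lsucc x y) (at level 40, left associativity) : ring_scope.

Section LAlgebraTheory.
Variable k : fieldType.
Implicit Types V W B C P : lAlgebraType k.

Definition lalg_hom V W (f : V -> W) : Prop :=
  [/\ linear f,
      {morph f : x y / x ≺ y >-> x ≺ y} &
      {morph f : x y / x ≻ y >-> x ≻ y}].

Definition lalg_embedding V W (f : V -> W) : Prop :=
  lalg_hom f /\ injective f.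

Definition subspace (V : lmodType k) (D : set V) : Prop :=
  D 0 /\ forall (a : k) u v, D u -> D v -> D (a *: u + v).

Definition lalg_ideal V (I : set V) : Prop :=
  subspace I /\
  forall f a, I f -> [/\ I (a ≺ f), I (f ≺ a), I (a ≻ f) & I (f ≻ a)].

Definition lalg_simple V : Prop :=
  forall I : set V, lalg_ideal I -> I = [set 0] \/ I = [set: V].

Definition subalgebra V (D : set V) : Prop :=
  subspace D /\ forall x y, D x -> D y -> D (x ≺ y) /\ D (x ≻ y).

Definition lalg_generated V (X : set V) : set V := smallest (@subalgebra V) X.

Definition is_free_product B C P (e1 : B -> P) (e2 : C -> P) : Prop :=
  [/\ lalg_hom e1, lalg_hom e2 &
      forall (L : lAlgebraType k) (f1 : B -> L) (f2 : C -> L),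
        lalg_hom f1 -> lalg_hom f2 ->
        exists f : P -> L,
          [/\ lalg_hom f, f \o e1 =1 f1, f \o e2 =1 f2 &
              forall g : P -> L, lalg_hom g ->
                g \o e1 =1 f1 -> g \o e2 =1 f2 -> g =1 f]].

Definition lin_indep (V : lmodType k) (X : set V) : Prop :=
  forall (s : seq V) (c : V -> k),
    uniq s -> (forall v, v \in s -> X v) ->
    \sum_(v <- s) c v *: v = 0 -> forall v, v \in s -> c v = 0.

Definition spanning (V : lmodType k) (X : set V) : Prop :=
  forall v : V, exists (s : seq V) (c : V -> k),
    (forall u, u \in s -> X u) /\ v = \sum_(u <- s) c u *: u.

Definition hamel_basis (V : lmodType k) (X : set V) : Prop :=
  lin_indep X /\ spanning X.

(* |T| <= dim_k V, where dim_k V is the cardinality of a (Hamel) basis of V;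
   since all bases of V are equipotent, the choice of X is immaterial. *)
Definition card_le_dim (T : Type) (V : lmodType k) : Prop :=
  exists X : set V, hamel_basis X /\ [set: T] #<= X.

End LAlgebraTheory.

(* Main.v *)
Require Import Defs.
From HB Require Import structures.
From mathcomp Require Import all_boot all_order all_algebra.
From mathcomp Require Import boolp classical_sets functions cardinality.

Set Implicit Arguments.
Unset Strict Implicit.
Unset Printing Implicit Defensive.

Import GRing.Theory.

Local Open Scope classical_set_scope.
Local Open Scope card_scope.
Local Open Scope ring_scope.

(** The axiom [(x ≻ y) ≺ z = x ≻ (y ≺ z)] says only that each left operator
    [x ≻ _] commutes with each right operator [_ ≺ z].  So an L-algebra is a
    vector space with two linear families of mutually commuting operators, and
    the operators of elements independent of [A], [B] and [C] can be prescribed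
    almost at will.

    Fix a basis element [b0] of [B].  Suppose that [A], [B], [C] sit in an
    L-algebra [L] whose subalgebra generated by [B] and [C] contains, for every
    [x] in [A], [B] or [C], two elements [m] and [m'] with
    [m ≻ (x ≺ m) = b0] if [x] is nonzero, and [m' ≻ (b0 ≺ m') = x].
    Let [f : P -> L] extend the inclusions of [B] and [C].  The second equation
    puts [A] in the range of [f].  Let [J] be an ideal of [P] maximal among those
    that contain [ker f] and miss [w = e1 b0] ([maximal_ideal]).  A strictly
    larger ideal contains [w], hence [e1 B] and [e2 C] by the second equation,
    hence [P], which they generate ([free_product_ind]): so [P / J] is simple.
    If the class in [P / J] of a nonzero [x] from [A], [B] or [C] were zero, the
    first equation would put [w] in [J]: so [A], [B] and [C] embed in [P / J].

    The algebra [L] is built in two steps.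
    - A space [N] containing [A], [B], [C] on which the basis elements of the
      three algebras act by commuting left and right operators.  The products of
      [B] and [C] create in [N] a vector [marker i] spelling a word in the bases
      of [B] and [C], and distinct words give independent vectors.
    - Functions of two words (one acting from the left, one from the right) with
      values in [N].  Shifting the left word commutes with shifting the right
      one, which yields the L-algebra law for free; sending [x : N] to the
      function [(l, r) |-> reduce l x r], where [reduce] computes the action of
      the two words on [x], embeds [N] compatibly with the old operators and
      gives the markers the prescribed behaviour ([envelope],
      [word_envelope]).

    Finally there must be enough words, two for each [x]: [A], [B] and [C] have to
    inject into the words over a basis of [B] and a basis of [C].  All three inject in [P];
    monomials span [P], so a basis [X] of [P] injects into the pairs of a
    monomial and a number; as [|k| <= |X|], the combinations of vectors of [X] can
    be coded by trees, and trees by words ([index_words]). *)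

(** * Zorn's lemma above a given set *)

(** The chain hypothesis speaks of nonempty chains only, which is what a union of
    subspaces or ideals needs in order to contain zero. *)
Lemma Zorn_above (T : Type) (Q : set (set T)) (A0 : set T) :
  Q A0 ->
  (forall F : set (set T), F !=set0 -> F `<=` Q -> total_on F subset ->
     Q (\bigcup_(X in F) X)) ->
  exists A, [/\ A0 `<=` A, Q A & forall B, A `<=` B -> Q B -> B = A].
Proof.
move=> Q0 Qch.
(* The empty set is added so that the union of the empty chain is allowed. *)
pose Q' : set (set T) := [set A | A = set0 \/ (A0 `<=` A /\ Q A)].
have [F sFQ tF|A [QA maxA]] := @Zorn_bigcup T Q'.
  pose F' := [set X | F X /\ (A0 `<=` X /\ Q X)].
  have [[X0 F'X0]|F'0] := pselect (F' !=set0); last first.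
    left; apply/seteqP; split=> // x [X FX Xx].
    case: (sFQ _ FX) => [X0|HX]; first by move: Xx; rewrite X0.
    by exfalso; apply: F'0; exists X.
  have -> : \bigcup_(X in F) X = \bigcup_(X in F') X.
    apply/seteqP; split=> x [X FX Xx]; last by exists X => //; case: FX.
    case: (sFQ _ FX) => [X0'|HX]; first by move: Xx; rewrite X0'.
    by exists X.
  right; split; first by move=> x A0x; exists X0 => //; case: F'X0 => _ [+ _]; apply.
  apply: Qch; first by exists X0.
  - by move=> X [_ []].
  - by move=> X Y [FX _] [FY _]; apply: tF.
have maxA' B : A `<=` B -> A0 `<=` B -> Q B -> B = A.
  move=> sAB sB QB; apply: contrapT => nBA; apply: (maxA B); last by right.
  split=> // sBA; apply: nBA; exact/seteqP.
case: QA => [A_0|[sA QA]].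
  have A0A : A0 = A by apply: maxA' => //; rewrite A_0.
  exists A; rewrite -A0A; split=> // B sAB QB.
  by rewrite [RHS]A0A; apply: maxA' => //; rewrite -A0A.
exists A; split=> // B sAB; apply: maxA' => //; exact: subset_trans sAB.
Qed.

(** * Linear combinations, bases and linear extension *)

Section LinearAlgebra.
Variable k : fieldType.

Lemma linear_sum (V W : lmodType k) (f : V -> W) : linear f ->
  forall I (s : seq I) (P : pred I) (F : I -> V),
  f (\sum_(i <- s | P i) F i) = \sum_(i <- s | P i) f (F i).
Proof.
move=> lf; pose f' : {linear V -> W} := HB.pack f (GRing.isLinear.Build _ _ _ _ f lf).
by move=> *; exact: (raddf_sum f').
Qed.

Lemma linear_0 (V W : lmodType k) (f : V -> W) : linear f -> f 0 = 0.
Proof.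
by move=> lf; apply: (addIr (f 0)); rewrite add0r -[X in X + _]scale1r -lf scale1r addr0.
Qed.

Lemma linear_scale (V W : lmodType k) (f : V -> W) : linear f ->
  forall a x, f (a *: x) = a *: f x.
Proof. by move=> lf a x; rewrite -[a *: x]addr0 lf linear_0 // addr0. Qed.

Lemma linear_add (V W : lmodType k) (f : V -> W) : linear f ->
  {morph f : x y / x + y}.
Proof. by move=> lf x y; rewrite -[x]scale1r lf !scale1r. Qed.

Lemma linear_sub (V W : lmodType k) (f : V -> W) : linear f ->
  {morph f : x y / x - y}.
Proof. by move=> lf x y; rewrite -!scaleN1r linear_add // linear_scale. Qed.

Lemma linear_comp (U V W : lmodType k) (f : V -> W) (g : U -> V) :
  linear f -> linear g -> linear (f \o g).
Proof. by move=> lf lg a x y /=; rewrite lg lf. Qed.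

(** Combinations are taken over lists of pairs, with repetitions allowed: they add
    by concatenation, and [coef] collects the terms. *)
Definition lc (V : lmodType k) (I : Type) (F : I -> V) (s : seq (k * I)) : V :=
  \sum_(p <- s) p.1 *: F p.2.

Lemma lc_cat (V : lmodType k) I (F : I -> V) s t : lc F (s ++ t) = lc F s + lc F t.
Proof. by rewrite /lc big_cat. Qed.

Lemma lc_scale (V : lmodType k) I (F : I -> V) a s :
  lc F [seq (a * p.1, p.2) | p <- s] = a *: lc F s.
Proof. by rewrite /lc big_map scaler_sumr; apply: eq_bigr => p _; rewrite scalerA. Qed.

Lemma linear_lc (V W : lmodType k) (f : V -> W) I (F : I -> V) s : linear f ->
  f (lc F s) = lc (f \o F) s.
Proof.
by move=> lf; rewrite /lc linear_sum //; apply: eq_bigr => p _; rewrite linear_scale.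
Qed.

Lemma eq_lc (V : lmodType k) I (F G : I -> V) s : F =1 G -> lc F s = lc G s.
Proof. by move=> FG; apply: eq_bigr => p _; rewrite FG. Qed.

Definition fspan (V : lmodType k) I (F : I -> V) : set V := [set x | exists s, x = lc F s].

Lemma fspan_subspace (V : lmodType k) I (F : I -> V) : subspace (fspan F).
Proof.
split; first by exists [::]; rewrite /lc big_nil.
move=> a _ _ [s ->] [t ->].
by exists ([seq (a * p.1, p.2) | p <- s] ++ t); rewrite lc_cat lc_scale.
Qed.

Lemma fspan_gen (V : lmodType k) I (F : I -> V) i : fspan F (F i).
Proof. by exists [:: (1, i)]; rewrite /lc big_seq1 scale1r. Qed.

Lemma subspaceD (V : lmodType k) (D : set V) u v : subspace D -> D u -> D v -> D (u + v).
Proof. by move=> [_ h] Du Dv; rewrite -[u]scale1r; exact: h. Qed.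

Lemma subspaceZ (V : lmodType k) (D : set V) a u : subspace D -> D u -> D (a *: u).
Proof. by move=> [d0 h] Du; rewrite -[_ *: _]addr0; exact: h. Qed.

Lemma subspaceB (V : lmodType k) (D : set V) u v : subspace D -> D u -> D v -> D (u - v).
Proof. by move=> sD Du Dv; rewrite -scaleN1r; apply: subspaceD=> //; exact: subspaceZ. Qed.

Lemma fspan_min (V : lmodType k) I (F : I -> V) (D : set V) :
  subspace D -> (forall i, D (F i)) -> fspan F `<=` D.
Proof.
move=> sD DF _ [s ->]; rewrite /lc; elim: s => [|p s IH]; first by rewrite big_nil; case: sD.
by rewrite big_cons; apply: subspaceD => //; exact: subspaceZ.
Qed.

Lemma linear_preimage_subspace (V W : lmodType k) (f : V -> W) (D : set W) :
  linear f -> subspace D -> subspace (f @^-1` D).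
Proof.
move=> lf [D0 DL]; split; first by rewrite /preimage /= linear_0.
by move=> a u v Du Dv; rewrite /preimage /= lf; exact: DL.
Qed.

Definition coef (I : eqType) (s : seq (k * I)) (i : I) : k := \sum_(p <- s | p.2 == i) p.1.

Definition free_family (V : lmodType k) (I : eqType) (F : I -> V) :=
  forall s, lc F s = 0 -> forall i, coef s i = 0.

Lemma lc_coef (V : lmodType k) (I : eqType) (F : I -> V) s :
  lc F s = \sum_(i <- undup (map snd s)) coef s i *: F i.
Proof.
under eq_bigr => i _ do rewrite /coef scaler_suml big_mkcond /=.
rewrite exchange_big /= /lc big_seq [RHS]big_seq; apply: eq_bigr => p ps.
have pi : p.2 \in undup (map snd s) by rewrite mem_undup map_f.
rewrite (bigD1_seq _ pi (undup_uniq _)) /= eqxx big1 ?addr0 //.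
by move=> i /negbTE; rewrite eq_sym => ->.
Qed.

Lemma coef_lc (I : eqType) s (i : I) :
  coef s i = lc (fun j => ((j == i)%:R : k^o)) s.
Proof.
rewrite /coef /lc big_mkcond; apply: eq_bigr => p _.
by case: (p.2 == i); rewrite ?scaler0 // /GRing.scale /= mulr1.
Qed.

(** The practical test of independence below: it suffices to read each index off
    by a functional of its own. *)
Lemma biorthogonal_free (V : lmodType k) (I : eqType) (F : I -> V) (psi : I -> V -> k^o) :
  (forall i, linear (psi i)) -> (forall i j, psi i (F j) = (j == i)%:R) ->
  free_family F.
Proof.
move=> lp pF s s0 i; have := linear_lc F s (lp i); rewrite s0 linear_0 // coef_lc => ->.
by apply: (@eq_lc k^o) => j; rewrite /= pF.
Qed.

(** The values of the extension lie in the span of the prescribed ones; this is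
    what makes operators extended from commuting families commute.  The proof
    takes a maximal linear relation between [V] and [W] that is functional,
    contains the prescribed pairs and has its values in the span. *)
Lemma linear_extension (V W : lmodType k) (I : eqType) (F : I -> V) (f : I -> W) :
  free_family F ->
  exists T : V -> W, [/\ linear T, T \o F =1 f & forall x, fspan f (T x)].
Proof.
move=> frF.
pose Q : set (set (V * W)) := [set R | [/\ @subspace k (V * W)%type R,
   forall w, R (0, w) -> w = 0 & forall x w, R (x, w) -> fspan f w]].
pose R0 : set (V * W) := [set p | exists s, p = (lc F s, lc f s)].
have Q0 : Q R0.
  split.
  - split; first by exists [::]; rewrite /lc !big_nil.
    move=> a _ _ [s ->] [t ->]; exists ([seq (a * p.1, p.2) | p <- s] ++ t).
    by rewrite !lc_cat !lc_scale.
  - move=> w [s [s0 ->]]; rewrite lc_coef big1 // => i _.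
    by rewrite frF ?scale0r.
  - by move=> x w [s [_ ->]]; exists s.
have [FF [X0 FX0] sFQ tF|R [R0R [[R_0 RL] Rf Rs] Rmax]] := @Zorn_above _ Q R0 Q0.
  split.
  - split; first by exists X0 => //; have [[+ _] _ _] := sFQ _ FX0.
    move=> a u v [X FX Xu] [Y FY Yv].
    case: (tF _ _ FX FY) => sXY.
    + by exists Y => //; have [[_ L] _ _] := sFQ _ FY; apply: L; [exact: sXY|].
    + by exists X => //; have [[_ L] _ _] := sFQ _ FX; apply: L; [|exact: sXY].
  - by move=> w [X FX Xw]; have [_ + _] := sFQ _ FX; apply.
  - by move=> x w [X FX Xw]; have [_ _ +] := sFQ _ FX; apply; exact: Xw.
have tot x : exists w, R (x, w).
  apply: contrapT => nx.
  (* Adjoining the pair (x, 0) keeps the relation functional. *)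
  pose R' : set (V * W) := [set p | exists a, R (p.1 - a *: x, p.2)].
  have RR' : R `<=` R' by move=> [y w] Ry; exists 0; rewrite /= scale0r subr0.
  have QR' : Q R'.
    split.
    - split; first exact: RR'.
      move=> a [y w] [y' w'] [b Rb] [b' Rb']; exists (a * b + b').
      have e : a *: y + y' - (a * b + b') *: x = a *: (y - b *: x) + (y' - b' *: x).
        by rewrite scalerDl -scalerA opprD scalerBr addrACA.
      suff : R (a *: y + y' - (a * b + b') *: x, a *: w + w') by [].
      by rewrite e; exact: (RL a _ _ Rb Rb').
    - move=> w [a]; rewrite /= sub0r => Ra.
      have [a0|an0] := eqVneq a 0; first by move: Ra; rewrite a0 scale0r oppr0; exact: Rf.
      case: nx; exists (- a^-1 *: w).
      have e : x = - a^-1 *: (- (a *: x)) + 0.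
        by rewrite addr0 scalerN scaleNr opprK scalerA mulVf // scale1r.
      suff : R (x, - a^-1 *: w + 0) by rewrite addr0.
      by rewrite [X in R (X, _)]e; exact: (RL (- a^-1) _ _ Ra R_0).
    - by move=> y w [a /Rs].
  have R'R := Rmax _ RR' QR'.
  by case: nx; exists 0; rewrite -R'R; exists 1; rewrite /= scale1r subrr.
have Rfun x w w' : R (x, w) -> R (x, w') -> w = w'.
  move=> h h'; apply/eqP; rewrite -subr_eq0; apply/eqP/Rf.
  have e : 0 = (-1) *: x + x :> V by rewrite scaleN1r addNr.
  rewrite e -[w - w']addrC -scaleN1r; exact: (RL (-1) _ _ h' h).
have [T RT] := choice tot; exists T; split.
- move=> a x y; apply: (Rfun (a *: x + y)) => //.
  by have := RL a _ _ (RT x) (RT y).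
- move=> i /=; apply: (Rfun (F i)) => //; apply: R0R.
  by exists [:: (1, i)]; rewrite /lc !big_seq1 !scale1r.
- by move=> x; apply: Rs (RT x).
Qed.

Lemma lin_indep_free (V : lmodType k) (X : set V) :
  lin_indep X -> free_family (fun x : set_type X => val x).
Proof.
move=> iX s s0 i.
pose s' := map (fun p => (p.1, val p.2)) s.
have c's' j : coef s' (val j) = coef s j.
  by rewrite /coef big_map; apply: eq_bigl => p /=; rewrite (inj_eq val_inj).
have [iu|iu] := boolP (val i \in undup (map snd s')); last first.
  rewrite /coef big_seq_cond big_pred0 // => p; apply/negP => /andP[ps /eqP pi].
  by move/negP: iu; apply; rewrite mem_undup -map_comp; apply/mapP; exists p; rewrite //= pi.
rewrite -c's'; apply: (iX (undup (map snd s')) (coef s')) => //.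
- exact: undup_uniq.
- move=> v; rewrite mem_undup -map_comp => /mapP[p _ ->] /=.
  exact: set_mem (valP p.2).
- by rewrite -(lc_coef id) -s0 /lc big_map.
Qed.

Lemma spanning_fspan (V : lmodType k) (X : set V) :
  spanning X -> forall v, fspan (fun x : set_type X => val x) v.
Proof.
move=> sX v; have [s [c [sX' ->]]] := sX v.
elim: s sX' => [|u s IH] sX'.
  by rewrite big_nil; case: (fspan_subspace (fun x : set_type X => val x)).
rewrite big_cons; apply: subspaceD; first exact: fspan_subspace; last first.
  by apply: IH => w ws; apply: sX'; rewrite inE ws orbT.
apply: subspaceZ; first exact: fspan_subspace.
have Xu : u \in X by apply/mem_set/sX'; rewrite inE eqxx.
exact: (@fspan_gen V (set_type X) (fun x => val x) (SigSub Xu)).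
Qed.

Lemma hamel_exists (V : lmodType k) : exists X : set V, hamel_basis X.
Proof.
have i0 : lin_indep (set0 : set V).
  by move=> s c _ s0 _ v vs; case: (s0 v vs).
have [F [X0 FX0] sF tF|X [_ iX maxX]] := @Zorn_above _ (@lin_indep k V) set0 i0.
  move=> s c us sU s0.
  have [X FX sX] : exists2 X, F X & forall v, v \in s -> X v.
    elim: s {us s0} sU => [|u s IH] sU; first by exists X0.
    have [w ws|X FX sX] := IH; first by apply: sU; rewrite inE ws orbT.
    have [Y FY Yu] := sU u (mem_head _ _).
    case: (tF _ _ FX FY) => sXY; [exists Y|exists X] => // v; rewrite inE => /orP[/eqP ->|vs] //.
    - by apply: sXY; exact: sX.
    - exact: sXY.
    - exact: sX.
  exact: (sF _ FX).
exists X; split=> // v.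
pose v' := fun x : set_type X => val x.
(* The repetitions of the list are merged by coef to get a combination of
   distinct vectors. *)
suff [s ->] : fspan v' v.
  pose s' := map (fun p => (p.1, val p.2)) s.
  exists (undup (map snd s')), (coef s'); split.
    move=> u; rewrite mem_undup -map_comp => /mapP[p _ ->] /=.
    exact: set_mem (valP p.2).
  by rewrite -(lc_coef id) /lc big_map.
apply: contrapT => nv.
have spX : forall u, X u -> fspan v' u.
  by move=> u /mem_set Xu; exact: (@fspan_gen V (set_type X) v' (SigSub Xu)).
have : (X `|` [set v]) = X.
  apply: maxX; first exact: subsetUl.
  move=> s c us sU s0.
  have sX u : u \in s -> u != v -> X u.
    by move=> us' uv; case: (sU u us') => // /eqP; rewrite (negbTE uv).
  have [vs|vs] := boolP (v \in s); last first.
    by apply: iX => // u us'; apply: sX => //; apply: contraNneq vs => <-.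
  move: s0; rewrite (bigD1_seq v) //= -big_filter => s0.
  have cv : c v = 0.
    apply: contrapT => /eqP cv; apply: nv.
    have -> : v = (- (c v)^-1) *: \sum_(i <- [seq i <- s | i != v]) c i *: i.
      rewrite -[X in _ *: X](addKr (c v *: v)) s0 addr0 scaleNr scalerN opprK.
      by rewrite scalerA mulVf // scale1r.
    apply: subspaceZ; first exact: fspan_subspace.
    rewrite big_filter; elim: s sX {us sU vs s0} => [|u s IH] sX.
      by rewrite big_nil; case: (fspan_subspace v').
    have IH' : fspan v' (\sum_(i <- s | i != v) c i *: i).
      by apply: IH => w ws; apply: sX; rewrite inE ws orbT.
    rewrite big_cons; case: ifP => // uv; apply: subspaceD => //; first exact: fspan_subspace.
    apply: subspaceZ; first exact: fspan_subspace.
    by apply: spX; apply: sX => //; rewrite mem_head.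
  move: s0; rewrite cv scale0r add0r => s0 u us'.
  have [->//|uv] := eqVneq u v.
  apply: (iX _ c _ _ s0); first exact: filter_uniq.
  - by move=> w; rewrite mem_filter => /andP[wv ws]; exact: sX.
  - by rewrite mem_filter uv.
by move=> XE; apply: nv; apply: spX; rewrite -XE; right.
Qed.

Lemma dual_basis (V : lmodType k) (X : set V) : hamel_basis X ->
  exists psi : set_type X -> V -> k^o, (forall x, linear (psi x)) /\
    forall x y, psi x (val y) = (y == x)%:R.
Proof.
move=> [iX _].
have /choice[psi Hpsi] : forall x : set_type X, exists f : V -> k^o,
    linear f /\ forall y : set_type X, f (val y) = (y == x)%:R.
  move=> x; have [T [lT TE _]] :=
    linear_extension (fun y : set_type X => ((y == x)%:R : k^o)) (lin_indep_free iX).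
  by exists T.
by exists psi; split=> x; [exact: (Hpsi x).1|exact: (Hpsi x).2].
Qed.

Lemma nonzero_functional (V : lmodType k) (v : V) : v != 0 ->
  exists f : V -> k^o, linear f /\ f v = 1.
Proof.
move=> v0; have fr : free_family (fun _ : unit => v).
  move=> s; rewrite /lc -scaler_suml => /eqP; rewrite scaler_eq0 (negbTE v0) orbF => /eqP s0 [].
  by rewrite /coef -[RHS]s0.
have [T [lT TE _]] := linear_extension (fun _ : unit => (1 : k^o)) fr.
by exists T; split=> //; exact: (TE tt).
Qed.

Lemma linear_fspan_eq (V W : lmodType k) I (F : I -> V) (f g : V -> W) :
  linear f -> linear g -> (forall v, fspan F v) -> f \o F =1 g \o F -> f =1 g.
Proof.
by move=> lf lg sF fg v; have [s ->] := sF v; rewrite !linear_lc //; exact: eq_lc.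
Qed.

End LinearAlgebra.

(** * Subalgebras and quotients as L-algebras *)

Section Subalgebra.
Variables (k : fieldType) (V : lAlgebraType k) (D : set V).
Hypothesis subD : subalgebra D.

Let Dp : pred V := fun v => `[<D v>].

Lemma subalgebra_type :
  exists (L : lAlgebraType k) (i : L -> V), [/\ lalg_hom i, injective i & range i = D].
Proof.
have [[D0 DL] DM] := subD.
have Dsub : GRing.submod_closed Dp.
  split; first exact/asboolP.
  by move=> a u v /asboolP Du /asboolP Dv; apply/asboolP/DL.
pose U : choiceType := {v : V | Dp v}.
pose mU := GRing.SubChoice_isSubLmodule.Build k V Dp U (GRing.submod_closed_semi Dsub).
pose UL : lmodType k := HB.pack U mU.
pose val' : UL -> V := sval.
have vL : linear val' by [].
have vD (x : UL) : D (val' x) by have /asboolP := valP x.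
have vI : injective val' by exact: val_inj.
have pP (x y : UL) : Dp (val' x ≺ val' y) by apply/asboolP; have [] := DM _ _ (vD x) (vD y).
have sP (x y : UL) : Dp (val' x ≻ val' y) by apply/asboolP; have [] := DM _ _ (vD x) (vD y).
pose p (x y : UL) : UL := exist (fun v => Dp v) _ (pP x y).
pose s (x y : UL) : UL := exist (fun v => Dp v) _ (sP x y).
have vp x y : val' (p x y) = val' x ≺ val' y by [].
have vs x y : val' (s x y) = val' x ≻ val' y by [].
have p1 z : linear (fun x => p x z).
  by move=> a x y; apply: vI; rewrite vL !vp vL lprec_linearl.
have p2 z : linear (p z).
  by move=> a x y; apply: vI; rewrite vL !vp vL lprec_linearr.
have s1 z : linear (fun x => s x z).
  by move=> a x y; apply: vI; rewrite vL !vs vL lsucc_linearl.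
have s2 z : linear (s z).
  by move=> a x y; apply: vI; rewrite vL !vs vL lsucc_linearr.
have ps x y z : p (s x y) z = s x (p y z).
  by apply: vI; rewrite !(vp, vs) lsucc_lprecA.
pose L : lAlgebraType k := HB.pack UL (Lmodule_isLAlgebra.Build k UL p1 p2 s1 s2 ps).
exists L, val'; split=> //.
apply/seteqP; split=> [_ [x _ <-]|v Dv]; first exact: vD.
have Dv' : Dp v by exact/asboolP.
by exists (exist (fun v => Dp v) v Dv').
Qed.

End Subalgebra.

Local Open Scope quotient_scope.

Section Quotient.
Variables (k : fieldType) (V : lAlgebraType k) (J : set V).
Hypothesis idJ : lalg_ideal J.

Definition ideal_pred (_ : lalg_ideal J) : {pred V} := fun v => `[<J v>].

Fact ideal_pred_closed : zmod_closed (ideal_pred idJ).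
Proof.
have [sJ _] := idJ; split; first by apply/asboolP; case: sJ.
by move=> u v /asboolP Ju /asboolP Jv; apply/asboolP; exact: subspaceB sJ Ju Jv.
Qed.

HB.instance Definition _ := GRing.isZmodClosed.Build V (ideal_pred idJ) ideal_pred_closed.

Lemma quotient_type :
  exists (S : lAlgebraType k) (pi : V -> S),
    [/\ lalg_hom pi, range pi = [set: S] & forall v, pi v = 0 <-> J v].
Proof.
have [sJ mJ] := idJ.
pose Q : zmodType := {ideal_quot (ideal_pred idJ)}.
pose pi (v : V) : Q := \pi_{ideal_quot (ideal_pred idJ)} v.
have piEq x y : J (x - y) -> pi x = pi y.
  by move=> Jxy; apply/eqP; rewrite -Quotient.idealrBE; apply/asboolP.
have piJ x y : pi x = pi y -> J (x - y).
  by move=> /eqP; rewrite -Quotient.idealrBE => /asboolP.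
have piD x y : pi (x + y) = pi x + pi y by rewrite /pi !piE.
pose rp (x : Q) : V := repr (x : {ideal_quot (ideal_pred idJ)}).
have reprE x : pi (rp x) = x by exact: reprK.
pose sc a (x : Q) : Q := pi (a *: rp x).
have scE a x : sc a (pi x) = pi (a *: x).
  apply: piEq; rewrite -scalerBr; apply: subspaceZ => //; exact/piJ/reprE.
have surj (x : Q) : exists v, x = pi v by exists (rp x); rewrite reprE.
have scA a b (x : Q) : sc a (sc b x) = sc (a * b) x.
  by have [v ->] := surj x; rewrite !scE scalerA.
have sc1 : left_id 1 sc by move=> x; have [v ->] := surj x; rewrite scE scale1r.
have scDr : right_distributive sc +%R.
  move=> a x y; have [u ->] := surj x; have [v ->] := surj y.
  by rewrite -piD !scE scalerDr piD.
have scDl (x : Q) : {morph sc^~ x : a b / a + b}.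
  by move=> a b; have [v ->] := surj x; rewrite /= !scE scalerDl piD.
pose QL : lmodType k := HB.pack Q (GRing.Zmodule_isLmodule.Build k Q scA sc1 scDr scDl).
pose q : V -> QL := pi.
have qL : linear q by move=> a x y; rewrite /q piD -scE.
have qE x y : J (x - y) -> q x = q y by exact: piEq.
have qrepr (x : QL) : q (rp x) = x by exact: reprE.
have qJ x y : q x = q y -> J (x - y) by exact: piJ.
pose p (x y : QL) : QL := q (rp x ≺ rp y).
pose s (x y : QL) : QL := q (rp x ≻ rp y).
have qp x y : q (x ≺ y) = p (q x) (q y).
  apply: qE; set x' := rp _; set y' := rp _.
  have Jx : J (x - x') by apply: qJ; rewrite qrepr.
  have Jy : J (y - y') by apply: qJ; rewrite qrepr.
  have -> : x ≺ y - x' ≺ y' = (x - x') ≺ y + x' ≺ (y - y').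
    rewrite (linear_sub (lprec_linearl y)) (linear_sub (lprec_linearr x')).
    by rewrite addrA subrK.
  by apply: subspaceD => //; [have [] := mJ _ y Jx|have [] := mJ _ x' Jy].
have qs x y : q (x ≻ y) = s (q x) (q y).
  apply: qE; set x' := rp _; set y' := rp _.
  have Jx : J (x - x') by apply: qJ; rewrite qrepr.
  have Jy : J (y - y') by apply: qJ; rewrite qrepr.
  have -> : x ≻ y - x' ≻ y' = (x - x') ≻ y + x' ≻ (y - y').
    rewrite (linear_sub (lsucc_linearl y)) (linear_sub (lsucc_linearr x')).
    by rewrite addrA subrK.
  by apply: subspaceD => //; [have [] := mJ _ y Jx|have [] := mJ _ x' Jy].
have qsurj (x : QL) : exists v, x = q v by exists (rp x); rewrite qrepr.
have p1 z : linear (fun x => p x z).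
  move=> a x y; have [u ->] := qsurj x; have [v ->] := qsurj y; have [w ->] := qsurj z.
  by rewrite -qL -!qp lprec_linearl qL.
have p2 z : linear (p z).
  move=> a x y; have [u ->] := qsurj x; have [v ->] := qsurj y; have [w ->] := qsurj z.
  by rewrite -qL -!qp lprec_linearr qL.
have s1 z : linear (fun x => s x z).
  move=> a x y; have [u ->] := qsurj x; have [v ->] := qsurj y; have [w ->] := qsurj z.
  by rewrite -qL -!qs lsucc_linearl qL.
have s2 z : linear (s z).
  move=> a x y; have [u ->] := qsurj x; have [v ->] := qsurj y; have [w ->] := qsurj z.
  by rewrite -qL -!qs lsucc_linearr qL.
have ps x y z : p (s x y) z = s x (p y z).
  have [u ->] := qsurj x; have [v ->] := qsurj y; have [w ->] := qsurj z.
  by rewrite -!(qp, qs) lsucc_lprecA.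
pose L : lAlgebraType k := HB.pack QL (Lmodule_isLAlgebra.Build k QL p1 p2 s1 s2 ps).
exists L, q; split=> //.
- by apply/seteqP; split=> // x _; have [v ->] := qsurj x; exists v.
- move=> v; split=> [qv|Jv]; first by rewrite -[v]subr0; apply: qJ; rewrite (linear_0 qL).
  by have := @qE v 0; rewrite subr0 (linear_0 qL); apply.
Qed.
End Quotient.

(** * The free product is generated by its factors *)

Section FreeProduct.
Variables (k : fieldType) (B C P : lAlgebraType k) (e1 : B -> P) (e2 : C -> P).
Hypothesis hP : is_free_product e1 e2.

Lemma lalg_hom_comp (U V W : lAlgebraType k) (f : V -> W) (g : U -> V) :
  lalg_hom f -> lalg_hom g -> lalg_hom (f \o g).
Proof.
move=> [lf fp fs] [lg gp gs]; split; first exact: linear_comp.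
- by move=> x y; rewrite /= gp fp.
- by move=> x y; rewrite /= gs fs.
Qed.

(** The universal property, applied to the subalgebra [D] itself, gives a map
    [P -> D] whose composite with the inclusion must be the identity. *)
Lemma free_product_ind (D : set P) :
  subalgebra D -> (forall b, D (e1 b)) -> (forall c, D (e2 c)) -> D = [set: P].
Proof.
move=> subD D1 D2; have [L [i [hi iI iD]]] := subalgebra_type subD.
have [h1 h2 hU] := hP; have [li ip is_] := hi.
have lift (E : lAlgebraType k) (e : E -> P) : lalg_hom e -> (forall x, D (e x)) ->
    exists f : E -> L, lalg_hom f /\ forall x, i (f x) = e x.
  move=> [le ep es] De.
  have /choice[f fE] : forall x, exists y, i y = e x.
    by move=> x; have := De x; rewrite -iD => -[y _ <-]; exists y.
  exists f; split=> //; split.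
  - by move=> a x y; apply: iI; rewrite li !fE le.
  - by move=> x y; apply: iI; rewrite ip !fE ep.
  - by move=> x y; apply: iI; rewrite is_ !fE es.
have [f1 [hf1 f1E]] := lift _ _ h1 D1; have [f2 [hf2 f2E]] := lift _ _ h2 D2.
have [f [hf fe1 fe2 _]] := hU _ _ _ hf1 hf2.
have [g [_ _ _ gU]] := hU _ _ _ h1 h2.
have idP : id =1 g by apply: gU.
have ifP : i \o f =1 g.
  apply: gU; first exact: lalg_hom_comp.
  - by move=> x; rewrite -f1E; congr i; exact: fe1.
  - by move=> x; rewrite -f2E; congr i; exact: fe2.
apply/seteqP; split=> // v _; rewrite -iD; exists (f v) => //.
by rewrite [LHS]ifP -idP.
Qed.

(** The identity of [B] and the zero map of [C] extend to a retraction of [e1]. *)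
Lemma free_product_inj1 : injective e1.
Proof.
have [_ _ hU] := hP.
have h0 : lalg_hom (fun _ : C => 0 : B).
  split; first by move=> a x y; rewrite scaler0 addr0.
  - by move=> x y; rewrite (linear_0 (lprec_linearr _)).
  - by move=> x y; rewrite (linear_0 (lsucc_linearr _)).
have hid : lalg_hom (@id B) by [].
have [f [_ fe _ _]] := hU _ _ _ hid h0.
by move=> x y exy; rewrite -[x]fe -[y]fe /= exy.
Qed.

End FreeProduct.

Lemma free_product_sym (k : fieldType) (B C P : lAlgebraType k) (e1 : B -> P) (e2 : C -> P) :
  is_free_product e1 e2 -> is_free_product e2 e1.
Proof.
move=> [h1 h2 hU]; split=> // L f1 f2 hf1 hf2.
have [f [hf fe1 fe2 fU]] := hU L f2 f1 hf2 hf1.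
by exists f; split=> // g hg ge2 ge1; exact: fU.
Qed.

(** * Adjoining prescribed rank-one operators *)

(** [N] carries commuting operators [lop g] and [rop g]; they are to become the
    left and right operators of the vectors [v (inl g)], while [v (inr i)] is to
    act from both sides at once as the map [x |-> phi i x *: tgt i]. *)
Section Envelope.
Variables (k : fieldType) (N : lmodType k) (G I : eqType).
Variables (lop rop : G -> N -> N) (phi : I -> N -> k^o) (tgt : I -> N).
Hypothesis lop_linear : forall g, linear (lop g).
Hypothesis rop_linear : forall g, linear (rop g).
Hypothesis phi_linear : forall i, linear (phi i).
Hypothesis lop_rop : forall g h x, lop g (rop h x) = rop h (lop g x).

Fixpoint absorbr (x : N) (r : seq (G + I)) : N * option (I * seq (G + I)) :=
  match r with
  | [::] => (x, None)
  | inl g :: r' => absorbr (rop g x) r'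
  | inr i :: r' => (x, Some (i, r'))
  end.

(** In both words the letter next to [x] comes first, so that an operator applied
    earlier stands nearer the head.  Letters of [G] act one by one; letters of [I]
    are used up in pairs, one from each side, and this is what lets such a pair
    carry [x] back into [N]. *)
Fixpoint reduce (l : seq (G + I)) (x : N) (r : seq (G + I)) : N :=
  match l with
  | [::] => let: (y, o) := absorbr x r in if o is None then y else 0
  | inl g :: l' => reduce l' (lop g x) r
  | inr i :: l' =>
      if absorbr x r is (y, Some (j, r')) then
        if i == j then (phi i y : k) *: reduce l' (tgt i) r' else 0
      else 0
  end.

(** The only place where the commutation of [lop] with [rop] is used: the right
    letter moves through the left word, which [reduce] reads first. *)
Lemma reduce_ropE l x g r : reduce l x (inl g :: r) = reduce l (rop g x) r.
Proof. by elim: l x => [//|[h|i] l IH] x //=; rewrite IH lop_rop. Qed.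

(** What is left of the right word depends on that word alone, so that the case
    analysis of [reduce] is the same for all vectors. *)
Lemma absorbr_linear r :
  exists2 o, (forall x, (absorbr x r).2 = o) & linear (fun x => (absorbr x r).1).
Proof.
elim: r => [|[g|i] r [o oE lr]] /=.
- by exists None.
- by exists o => [x|a x y]; rewrite ?oE // rop_linear lr.
- by exists (Some (i, r)).
Qed.

Lemma reduce_linear l r : linear (fun x => reduce l x r).
Proof.
elim: l r => [|[g|i] l IH] r /= a x y.
- have [o oE lr] := absorbr_linear r; move: (lr a x y) (oE x) (oE y) (oE (a *: x + y)).
  case: (absorbr x r) => [x' ?]; case: (absorbr y r) => [y' ?].
  case: (absorbr _ r) => [z' ?] /= -> -> -> ->.
  by case: o {oE} => //; rewrite scaler0 addr0.
- by rewrite lop_linear IH.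
- have [o oE lr] := absorbr_linear r; move: (lr a x y) (oE x) (oE y) (oE (a *: x + y)).
  case: (absorbr x r) => [x' ?]; case: (absorbr y r) => [y' ?].
  case: (absorbr _ r) => [z' ?] /= -> -> -> ->.
  case: o {oE} => [[j r']|]; last by rewrite scaler0 addr0.
  case: (i == j); last by rewrite scaler0 addr0.
  by rewrite phi_linear scalerDl scalerA.
Qed.

Variable v : G + I -> N.
Hypothesis v_free : free_family v.

(** A letter acts on a function of two words by a shift of the left, resp. of the
    right, argument; [lsh g] and [rsh h] commute by computation. *)
Let H : lmodType k := seq (G + I) -> seq (G + I) -> N.
Let F (x : N) : H := fun l r => reduce l x r.
Let lsh (g : G + I) (h : H) : H := fun l r => h (g :: l) r.
Let rsh (g : G + I) (h : H) : H := fun l r => h l (g :: r).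

(** The operators of the elements of [H] are extended linearly from the shifts
    attached to the independent vectors [F (v g)]; since they stay in the span of
    the shifts, left and right ones commute. *)
Lemma envelope : exists (L : lAlgebraType k) (F : N -> L),
  [/\ linear F, injective F,
   forall g x, F (v (inl g)) ≻ F x = F (lop g x),
   forall g x, F x ≺ F (v (inl g)) = F (rop g x) &
   forall i x, F (v (inr i)) ≻ (F x ≺ F (v (inr i))) = (phi i x : k) *: F (tgt i)].
Proof.
have F_linear : linear F.
  by move=> a x y; apply/funext => l; apply/funext => r; exact: reduce_linear.
have F_nil x : F x [::] [::] = x by [].
have Fv_free : free_family (F \o v).
  move=> s s0; apply: v_free; rewrite -[LHS]F_nil linear_lc // s0 //.
have lsh_linear g : linear (lsh g) by [].
have rsh_linear g : linear (rsh g) by [].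
pose W : lmodType k := H -> H.
have [TL [TL_lin TL_v TL_span]] := @linear_extension k H W _ _ lsh Fv_free.
have [TR [TR_lin TR_v TR_span]] := @linear_extension k H W _ _ rsh Fv_free.
have lcE (op : G + I -> W) s h : lc op s h = lc (op^~ h) s.
  rewrite /lc; elim: s => [|p s IH]; rewrite ?big_nil // !big_cons -IH //.
have TL_h x : linear (TL x).
  have [s ->] := TL_span x; move=> a h h'; rewrite !lcE /lc scaler_sumr -big_split /=.
  by apply: eq_bigr => p _; rewrite lsh_linear scalerDr !scalerA mulrC.
have TR_h x : linear (TR x).
  have [s ->] := TR_span x; move=> a h h'; rewrite !lcE /lc scaler_sumr -big_split /=.
  by apply: eq_bigr => p _; rewrite rsh_linear scalerDr !scalerA mulrC.
pose p (x y : H) : H := TR y x.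
pose s (x y : H) : H := TL x y.
have p1 z : linear (fun x => p x z) by exact: TR_h.
have p2 z : linear (p z) by move=> a x y; rewrite /p TR_lin.
have s1 z : linear (fun x => s x z) by move=> a x y; rewrite /s TL_lin.
have s2 z : linear (s z) by exact: TL_h.
have ps x y z : p (s x y) z = s x (p y z).
  rewrite /p /s; have [t ->] := TR_span z; rewrite !lcE (linear_lc _ _ (TL_h x)).
  apply: eq_lc => g /=; have [u ->] := TL_span x; rewrite !lcE (linear_lc _ _ (rsh_linear g)).
  exact: eq_lc.
pose L : lAlgebraType k := HB.pack H (Lmodule_isLAlgebra.Build k H p1 p2 s1 s2 ps).
pose F' : N -> L := F.
have lE g h : F' (v g) ≻ (h : L) = lsh g h by have := TL_v g; rewrite /= => <-.
have rE g h : (h : L) ≺ F' (v g) = rsh g h by have := TR_v g; rewrite /= => <-.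
exists L, F'; split=> //.
- by move=> x y Fxy; rewrite -[x]F_nil -[F x]/(F' x) Fxy.
- move=> g x; apply: (etrans (rE (inl g) (F' x))).
  by apply/funext => l; apply/funext => r; exact: reduce_ropE.
- move=> i x; apply: (etrans (congr1 (lsucc (F' (v (inr i)))) (rE (inr i) (F' x)))).
  apply: (etrans (lE _ _)); apply/funext => l; apply/funext => r.
  by rewrite /lsh /rsh /F' /F /= eqxx.
Qed.
End Envelope.

(** * A space with enough independent products of B and C *)

(** Functions from words to [C] replace [C]: a vector of [C] sits at the empty
    word, and a basis letter of [B] or of [C] acts on the left by lengthening the
    words.  The right action of [C] is pointwise, hence commutes with this. *)
Section WordModule.
Variables (k : fieldType) (A B C : lAlgebraType k).
Variables (XA : set A) (XB : set B) (XC : set C).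
Hypotheses (hXA : hamel_basis XA) (hXB : hamel_basis XB) (hXC : hamel_basis XC).
Variables (b0 : set_type XB) (c0 : C).
Hypothesis c0_neq0 : c0 != 0.

Local Notation W := (set_type XB + set_type XC)%type.
Local Notation G := (set_type XA + W)%type.
Local Notation M := (seq W -> C).
Local Notation N := (A * B * M)%type.

Definition delta (w : seq W) (c : C) : M := fun w' => if w' == w then c else 0.
Definition push (x : W) (h : M) : M := fun w =>
  if w is y :: w' then if y == x then h w' else 0 else 0.

(** A letter of [C] multiplies at the empty word and lengthens a nonempty one; it
    must not create a word of length one, in order to preserve the products
    of [C]. *)
Definition lopC (z : set_type XC) (h : M) : M := fun w =>
  if w is y :: w' then if (y == inr z) && (w' != [::]) then h w' else 0
  else val z ≻ h [::].

Definition lop (g : G) (n : N) : N :=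
  match g with
  | inl x => (val x ≻ n.1.1, 0, 0)
  | inr (inl y) => (0, val y ≻ n.1.2, push (inl y) n.2)
  | inr (inr z) => (0, 0, lopC z n.2)
  end.

Definition rop (g : G) (n : N) : N :=
  match g with
  | inl x => (n.1.1 ≺ val x, 0, 0)
  | inr (inl y) => (0, n.1.2 ≺ val y, 0)
  | inr (inr z) => (0, 0, (fun w => n.2 w ≺ val z) : M)
  end.

Definition inA (a : A) : N := (a, 0, 0).
Definition inB (b : B) : N := (0, b, 0).
Definition inC (c : C) : N := (0, 0, delta [::] c).

Lemma pair_eq (T U : Type) (x x' : T) (y y' : U) : x = x' -> y = y' -> (x, y) = (x', y').
Proof. by move=> -> ->. Qed.

Lemma lop_linear g : linear (lop g).
Proof.
case: g => [x|[y|z]] a m n; rewrite /lop; apply: pair_eq => /=.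
- by apply: pair_eq; rewrite /= ?scaler0 ?addr0 // lsucc_linearr.
- by rewrite scaler0 addr0.
- by apply: pair_eq; rewrite /= ?scaler0 ?addr0 // lsucc_linearr.
- apply/funext => -[|u w] /=; rewrite /GRing.scale /GRing.add /= ?scaler0 ?addr0 //.
  by case: (u == _); rewrite ?scaler0 ?addr0.
- by apply: pair_eq; rewrite /= scaler0 addr0.
- apply/funext => -[|u w] /=; rewrite /GRing.scale /GRing.add /=; first by rewrite lsucc_linearr.
  by case: (_ && _); rewrite ?scaler0 ?addr0.
Qed.

Lemma rop_linear g : linear (rop g).
Proof.
case: g => [x|[y|z]] a m n; rewrite /rop; apply: pair_eq => /=.
- by apply: pair_eq; rewrite /= ?scaler0 ?addr0 // lprec_linearl.
- by rewrite scaler0 addr0.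
- by apply: pair_eq; rewrite /= ?scaler0 ?addr0 // lprec_linearl.
- by rewrite scaler0 addr0.
- by apply: pair_eq; rewrite /= scaler0 addr0.
- by apply/funext => w; rewrite /GRing.scale /GRing.add /= lprec_linearl.
Qed.

Let lp0 (V : lAlgebraType k) (x : V) : 0 ≺ x = 0.
Proof. exact: linear_0 (lprec_linearl x). Qed.
Let sr0 (V : lAlgebraType k) (x : V) : x ≻ 0 = 0.
Proof. exact: linear_0 (lsucc_linearr x). Qed.

Lemma push0 x : push x 0 = 0.
Proof. by apply/funext => -[|u w] //=; case: ifP. Qed.

Lemma lopC0 z : lopC z 0 = 0.
Proof. by apply/funext => -[|u w] //=; rewrite ?sr0 //; case: ifP. Qed.

Lemma lop_rop g h n : lop g (rop h n) = rop h (lop g n).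
Proof.
case: g => [x|[y|z]]; case: h => [x'|[y'|z']]; rewrite /lop /rop /=;
  rewrite ?lsucc_lprecA ?lp0 ?sr0 ?push0 ?lopC0 //.
- by congr (_, _); apply/funext => w; rewrite lp0.
- by congr (_, _); apply/funext => -[|u w] /=; rewrite ?lp0 //; case: ifP; rewrite ?lp0.
- by congr (_, _); apply/funext => -[|u w] /=; rewrite ?lsucc_lprecA //; case: ifP; rewrite ?lp0.
Qed.

Lemma delta_linear w : linear (delta w).
Proof.
move=> a c c'; apply/funext => w'; rewrite /delta /GRing.scale /GRing.add /=.
by case: ifP; rewrite ?scaler0 ?addr0.
Qed.

Lemma inA_linear : linear inA.
Proof. by move=> a x y; apply: pair_eq => /=; [apply: pair_eq => /=|]; rewrite ?scaler0 ?addr0. Qed.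
Lemma inB_linear : linear inB.
Proof. by move=> a x y; apply: pair_eq => /=; [apply: pair_eq => /=|]; rewrite ?scaler0 ?addr0. Qed.
Lemma inC_linear : linear inC.
Proof.
move=> a x y; apply: pair_eq => /=; [apply: pair_eq => /=|];
  by rewrite ?scaler0 ?addr0 ?delta_linear.
Qed.

Lemma push_delta x w c : push x (delta w c) = delta (x :: w) c.
Proof. by apply/funext => -[|u w'] //=; rewrite /delta eqseq_cons; case: (u == x). Qed.

Lemma lopC_delta z w c : w != [::] -> lopC z (delta w c) = delta (inr z :: w) c.
Proof.
move=> w0; apply/funext => -[|u w']; rewrite /lopC /delta.
  by rewrite eq_sym (negbTE w0) sr0.
rewrite eqseq_cons; case: (u == _) => //=.
by case: w' => //=; rewrite eq_sym (negbTE w0).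
Qed.

Lemma lopC_delta0 z c : lopC z (delta [::] c) = delta [::] (val z ≻ c).
Proof.
apply/funext => -[|u w'] //=; rewrite /delta /=.
by case: w' => [|? ?] /=; rewrite ?andbF ?if_same.
Qed.

Variables (I : choiceType) (word : I -> seq W).
Hypothesis word_inj : injective word.

(** The last letter [b0], of [B], keeps the letters of [C] in [word i] from being
    multiplied with [c0]; it also makes the word nonempty, hence the markers
    independent of [C]. *)
Definition marker (i : I) : N := (0, 0, delta (rcons (word i) (inl b0)) c0).

Definition gens (g : G + I) : N :=
  match g with
  | inl (inl x) => inA (val x)
  | inl (inr (inl y)) => inB (val y)
  | inl (inr (inr z)) => inC (val z)
  | inr i => marker i
  end.

Lemma gens_free : free_family gens.
Proof.
have [pA [lpA pAE]] := dual_basis hXA.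
have [pB [lpB pBE]] := dual_basis hXB.
have [pC [lpC pCE]] := dual_basis hXC.
have [f [lf fc0]] := nonzero_functional c0_neq0.
pose psi (g : G + I) (n : N) : k^o :=
  match g with
  | inl (inl x) => pA x n.1.1
  | inl (inr (inl y)) => pB y n.1.2
  | inl (inr (inr z)) => pC z (n.2 [::])
  | inr i => f (n.2 (rcons (word i) (inl b0)))
  end.
have nrc (w : seq W) y : ([::] == rcons w y) = false by case: w.
have nrc' (w : seq W) y : (rcons w y == [::]) = false by case: w.
apply: (@biorthogonal_free _ _ _ _ psi).
  by case=> [[x|[y|z]]|i] a m n; rewrite /psi /= ?lpA ?lpB ?lpC ?lf.
case=> [[x|[y|z]]|i]; case=> [[x'|[y'|z']]|i']; rewrite /psi /= /delta ?eqxx ?nrc ?nrc' //;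
  rewrite ?pAE ?pBE ?pCE ?(linear_0 (lpA _)) ?(linear_0 (lpB _));
  rewrite ?(linear_0 (lpC _)) ?(linear_0 lf) //.
rewrite eqseq_rcons eqxx andbT (inj_eq word_inj).
have -> : (inr i' == inr i :> G + I) = (i == i') by rewrite eq_sym.
by case: (i == i'); rewrite ?fc0 ?(linear_0 lf).
Qed.

Variables (phi : I -> N -> k^o) (tgt : I -> N).
Hypothesis phi_linear : forall i, linear (phi i).

(** The maps from [A], [B] and [C] are homomorphisms because, both products being
    linear, it is enough to multiply by basis elements, whose operators are
    [lop] and [rop].  The markers are generated letter by letter from
    [b0 ≻ c0]. *)
Lemma word_envelope : exists (L : lAlgebraType k) (F : N -> L) (m : I -> L),
  [/\ linear F /\ injective F,
     [/\ lalg_hom (F \o inA), lalg_hom (F \o inB) & lalg_hom (F \o inC)],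
     forall D : set L, subalgebra D -> (forall b, D (F (inB b))) ->
       (forall c, D (F (inC c))) -> forall i, D (m i) &
     forall i n, m i ≻ (F n ≺ m i) = (phi i n : k) *: F (tgt i)].
Proof.
have [L [F [lF iF Fl Fr Fm]]] :=
  @envelope k (A * B * (seq W -> C))%type G I lop rop phi tgt
    lop_linear rop_linear phi_linear lop_rop gens gens_free.
exists L, F, (F \o marker); split=> //.
  have hom (E : lAlgebraType k) (e : E -> N) (X : set E) (iota : set_type X -> G) :
      hamel_basis X -> linear e ->
      (forall x, gens (inl (iota x)) = e (val x)) ->
      (forall x y, lop (iota x) (e y) = e (val x ≻ y)) ->
      (forall x y, rop (iota x) (e y) = e (y ≺ val x)) -> lalg_hom (F \o e).
    move=> [_ sX] le vE lE rE; have lFe := linear_comp lF le.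
    split=> // x y.
    - apply: (linear_fspan_eq (f := fun y => F (e (x ≺ y)))
        (g := fun y => F (e x) ≺ F (e y)) _ _ (spanning_fspan sX)).
      + exact: (linear_comp lFe (lprec_linearr _)).
      + exact: (linear_comp (lprec_linearr _) lFe).
      + by move=> z /=; rewrite -vE Fr rE.
    - apply: (linear_fspan_eq (f := fun x => F (e (x ≻ y)))
        (g := fun x => F (e x) ≻ F (e y)) _ _ (spanning_fspan sX)).
      + exact: (linear_comp lFe (lsucc_linearl _)).
      + exact: (linear_comp (lsucc_linearl _) lFe).
      + by move=> z /=; rewrite -vE Fl lE.
  split.
  - apply: (hom _ _ XA inl) => //; exact: inA_linear.
  - apply: (hom _ _ XB (fun y => inr (inl y))) => //; first exact: inB_linear.
    move=> x y; rewrite /lop /inB /= push0 //.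
  - apply: (hom _ _ XC (fun z => inr (inr z))) => //; first exact: inC_linear.
    + by move=> x y; rewrite /lop /inC /= lopC_delta0.
    + move=> x y; rewrite /rop /inC /=; congr (_, _); apply/funext => w; rewrite /delta.
      by case: ifP; rewrite ?lp0.
move=> D [_ DM] DB DC i; rewrite /= /marker.
elim: (word i) => [|x w IH] /=.
  have -> : (0, 0, delta [:: inl b0] c0) = lop (inr (inl b0)) (inC c0) :> N.
    by rewrite /lop /inC /= sr0 push_delta.
  by rewrite -Fl; apply: (DM _ _ (DB _) (DC _)).2.
have w0 : rcons w (inl b0) != [::] by case: (w).
case: x => [y|z].
- have -> : (0, 0, delta (inl y :: rcons w (inl b0)) c0) =
      lop (inr (inl y)) (0, 0, delta (rcons w (inl b0)) c0) :> N.
    by rewrite /lop /= sr0 push_delta.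
  by rewrite -Fl; apply: (DM _ _ (DB _) IH).2.
- have -> : (0, 0, delta (inr z :: rcons w (inl b0)) c0) =
      lop (inr (inr z)) (0, 0, delta (rcons w (inl b0)) c0) :> N.
    by rewrite /lop /= lopC_delta.
  by rewrite -Fl; apply: (DM _ _ (DC _) IH).2.
Qed.

End WordModule.

(** * Counting: the free product injects into words *)

Section TreeCode.
Variables (W : choiceType) (w0 w1 : W).
Hypothesis w01 : w0 != w1.

(** A prefix code: the first letter tells a number from a letter, and [w1] ends
    the unary notation of a number. *)
Definition symbol_word (x : nat + W) : seq W :=
  match x with inl n => rcons (nseq n.+1 w0) w1 | inr w => [:: w1; w] end.

Lemma symbol_words_inj : injective (fun s : seq (nat + W) => flatten (map symbol_word s)).
Proof.
elim=> [|x s IH] [|y t] //=.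
- by case: y.
- by case: x.
have nseqE n m u v : nseq n w0 ++ w1 :: u = nseq m w0 ++ w1 :: v -> n = m /\ u = v.
  elim: n m => [|n IHn] [|m] //=.
  - by case.
  - by case=> /eqP; rewrite eq_sym (negbTE w01).
  - by case=> /eqP; rewrite (negbTE w01).
  - by case=> /IHn [-> ->].
case: x => [n|x]; case: y => [m|y] /=; rewrite ?cat_rcons.
- by case=> /nseqE [-> /IH ->].
- by case=> /eqP; rewrite (negbTE w01).
- by case=> /eqP; rewrite eq_sym (negbTE w01).
- by case=> -> /IH ->.
Qed.

Lemma tree_words : exists f : GenTree.tree W -> seq W, injective f.
Proof.
exists (fun t => flatten (map symbol_word (GenTree.encode t))) => t u /symbol_words_inj.
exact: (pcan_inj (@GenTree.codeK W)).
Qed.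

End TreeCode.

Section Cardinality.
Variables (k : fieldType) (B C P : lAlgebraType k) (e1 : B -> P) (e2 : C -> P).
Hypothesis hP : is_free_product e1 e2.
Variables (XB : set B) (XC : set C).
Hypotheses (hXB : hamel_basis XB) (hXC : hamel_basis XC).

Local Notation W := (set_type XB + set_type XC)%type.

(** A node labelled [0] stands for [≻] and any other one for [≺]. *)
Fixpoint monomial (t : GenTree.tree W) : P :=
  match t with
  | GenTree.Leaf (inl b) => e1 (val b)
  | GenTree.Leaf (inr c) => e2 (val c)
  | GenTree.Node 0 (t1 :: t2 :: _) => monomial t1 ≻ monomial t2
  | GenTree.Node _ (t1 :: t2 :: _) => monomial t1 ≺ monomial t2
  | _ => 0
  end.

Lemma bilinear_fspan (V : lmodType k) I (F : I -> V) (op : V -> V -> V) :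
  (forall z, linear (op^~ z)) -> (forall x, linear (op x)) ->
  (forall i j, fspan F (op (F i) (F j))) ->
  forall x y, fspan F x -> fspan F y -> fspan F (op x y).
Proof.
move=> opl opr opF x y Fx Fy; move: x Fx.
apply: (@fspan_min _ _ _ F [set x | fspan F (op x y)]).
  exact: (linear_preimage_subspace (opl y) (fspan_subspace F)).
move=> i; move: y Fy; apply: (@fspan_min _ _ _ F [set y | fspan F (op (F i) y)]).
  exact: (linear_preimage_subspace (opr (F i)) (fspan_subspace F)).
exact: opF.
Qed.

Lemma monomials_span p : fspan monomial p.
Proof.
have [[l1 _ _] [l2 _ _] _] := hP.
suff -> : fspan monomial = [set: P] by [].
apply: (free_product_ind hP).
- split; first exact: fspan_subspace.
  move=> x y Fx Fy; split.
  + apply: bilinear_fspan Fx Fy; [exact: lprec_linearl|exact: lprec_linearr|].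
    by move=> t u; exact: (fspan_gen monomial (GenTree.Node 1 [:: t; u])).
  + apply: bilinear_fspan Fx Fy; [exact: lsucc_linearl|exact: lsucc_linearr|].
    by move=> t u; exact: (fspan_gen monomial (GenTree.Node 0 [:: t; u])).
- move=> b; have := spanning_fspan hXB.2 b; move: b.
  apply: (fspan_min (linear_preimage_subspace l1 (fspan_subspace _))) => x.
  exact: (fspan_gen monomial (GenTree.Leaf (inl x))).
- move=> c; have := spanning_fspan hXC.2 c; move: c.
  apply: (fspan_min (linear_preimage_subspace l2 (fspan_subspace _))) => x.
  exact: (fspan_gen monomial (GenTree.Leaf (inr x))).
Qed.

Lemma card_le_inj (T U : Type) (X : set T) (Y : set U) :
  X #<= Y -> exists f : set_type X -> set_type Y, injective f.
Proof.
move=> /card_leP[f].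
by exists f => x y; apply: (inj (f := f)); rewrite in_setT.
Qed.

(** Each basis vector [x] has a nonzero coordinate on some monomial, as monomials
    span.  That monomial and the position of [x] in its decomposition
    determine [x]. *)
Lemma basis_code (X : set P) : hamel_basis X ->
  exists f : set_type X -> GenTree.tree W, injective f.
Proof.
move=> hX; have [psi [lpsi psiE]] := dual_basis hX.
have supp p : {s | p = lc (fun x : set_type X => val x) s}.
  by apply: cid; exact: (spanning_fspan hX.2 p).
have hit (x : set_type X) : exists t, psi x (monomial t) != 0.
  apply: contrapT => /forallNP nx.
  have px0 : psi x =1 (fun=> 0 : k^o).
    apply: (linear_fspan_eq (lpsi x) _ monomials_span) => [a u v|t /=].
      by rewrite scaler0 addr0.
    by apply/eqP; apply: contrapT => h; apply: (nx t); exact/negP.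
  have := psiE x x; rewrite px0 eqxx => /eqP; rewrite eq_sym oner_eq0 //.
have /choice[t tE] := hit.
pose s x := map snd (sval (supp (monomial (t x)))).
have xs x : x \in s x.
  apply/negPn; apply: contra (tE x) => nxs; apply/eqP.
  rewrite (svalP (supp (monomial (t x)))) linear_lc // /lc big_seq big1 // => q qs.
  rewrite /= psiE; case: eqP => [qx|_]; last by rewrite scaler0.
  by case/negP: nxs; rewrite -[X in X \in _]qx; exact: map_f.
exists (fun x => GenTree.Node (index x (s x)) [:: t x]).
move=> x y [ixy txy]; have sxy : s x = s y by rewrite /s txy.
by rewrite -(nth_index x (xs x)) ixy sxy nth_index.
Qed.

(** An element of [P] is a list of pairs of a scalar and a basis vector; scalars
    inject into the basis by the bound on [k]. *)
Lemma free_product_code : card_le_dim k P ->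
  exists f : P -> GenTree.tree W, injective f.
Proof.
move=> [X [hX kX]]; have [fX fX_inj] := basis_code hX.
have [fk fk_inj] := card_le_inj kX.
pose g (a : k) := fX (fk (SigSub (in_setT a))).
have g_inj : injective g by move=> a b /fX_inj /fk_inj /(congr1 val).
have supp p : {s | p = lc (fun x : set_type X => val x) s}.
  by apply: cid; exact: (spanning_fspan hX.2 p).
exists (fun p => GenTree.Node 0
  (map (fun q => GenTree.Node 0 [:: g q.1; fX q.2]) (sval (supp p)))).
move=> p q [] /inj_map e; rewrite (svalP (supp p)) (svalP (supp q)) e //.
by move=> [a x] [b y] /= [] /g_inj -> /fX_inj ->.
Qed.

(** [b0] and [c1] supply the two distinct letters that the coding of trees by words
    requires. *)
Lemma index_words (A : lAlgebraType k) (b0 : set_type XB) (c1 : set_type XC) :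
  card_le_dim k P -> [set: A] #<= [set: P] ->
  exists word : bool * (A + B + C) -> seq W, injective word.
Proof.
move=> hk /card_le_inj[fA fA_inj]; have [g g_inj] := free_product_code hk.
have [h h_inj] := @tree_words W (inl b0) (inr c1) isT.
have i1 := free_product_inj1 hP; have i2 := free_product_inj1 (free_product_sym hP).
exists (fun i : bool * (A + B + C) => h (match i with
  | (b, inl (inl a)) =>
      GenTree.Node (nat_of_bool b) [:: GenTree.Node 0 [:: g (val (fA (SigSub (in_setT a))))]]
  | (b, inl (inr x)) => GenTree.Node (nat_of_bool b) [:: GenTree.Node 1 [:: g (e1 x)]]
  | (b, inr x) => GenTree.Node (nat_of_bool b) [:: GenTree.Node 2 [:: g (e2 x)]]
  end)) => -[b i] [b' i'] /h_inj.
have bool_inj (c c' : bool) : c = c' :> nat -> c = c' by case: c; case: c'.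
case: i => [[a|x]|x]; case: i' => [[a'|x']|x'] // [] /bool_inj -> /g_inj.
- by move=> /val_inj /fA_inj [->].
- by move=> /i1 ->.
- by move=> /i2 ->.
Qed.

End Cardinality.

(** * Maximal ideals and the theorem *)

Lemma basis_neq0 (k : fieldType) (V : lmodType k) (X : set V) (x : set_type X) :
  hamel_basis X -> val x != 0.
Proof.
move=> /dual_basis[psi [lpsi psiE]]; apply/eqP => x0.
by have /eqP := psiE x x; rewrite x0 (linear_0 (lpsi x)) eqxx eq_sym oner_eq0.
Qed.

Lemma basis_inhabited (k : fieldType) (V : lmodType k) (X : set V) :
  hamel_basis X -> (exists v : V, v != 0) -> exists x : set_type X, True.
Proof.
move=> [_ sX] [v v0]; have [s vE] := spanning_fspan sX v.
by case: s vE v0 => [|[a x] s] ->; [rewrite /lc big_nil eqxx|exists x].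
Qed.

Lemma ideal_subalgebra (k : fieldType) (V : lAlgebraType k) (J : set V) :
  lalg_ideal J -> subalgebra J.
Proof. by move=> [sJ mJ]; split=> // x y Jx Jy; have [_ + _ +] := mJ _ y Jx. Qed.

Lemma hom_range (k : fieldType) (U V : lAlgebraType k) (f : U -> V) :
  lalg_hom f -> subalgebra (range f).
Proof.
move=> [lf fp fs]; split.
  split; first by exists 0; rewrite ?linear_0.
  by move=> a _ _ [u _ <-] [v _ <-]; exists (a *: u + v); rewrite ?lf.
move=> _ _ [u _ <-] [v _ <-]; split; first by exists (u ≺ v); rewrite ?fp.
by exists (u ≻ v); rewrite ?fs.
Qed.

Lemma hom_preimage_subalgebra (k : fieldType) (U V : lAlgebraType k) (f : U -> V) (D : set V) :
  lalg_hom f -> subalgebra D -> subalgebra (f @^-1` D).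
Proof.
move=> [lf fp fs] [sD mD]; split; first exact: linear_preimage_subspace.
by move=> x y Dx Dy; rewrite /preimage /= fp fs; exact: mD.
Qed.

Lemma hom_preimage_ideal (k : fieldType) (U V : lAlgebraType k) (f : U -> V) (I : set V) :
  lalg_hom f -> lalg_ideal I -> lalg_ideal (f @^-1` I).
Proof.
move=> [lf fp fs] [sI mI]; split; first exact: linear_preimage_subspace.
move=> u a Iu; have [h1 h2 h3 h4] := mI (f u) (f a) Iu.
by split; rewrite /preimage /= ?fp ?fs.
Qed.

Lemma ideal0 (k : fieldType) (V : lAlgebraType k) : lalg_ideal [set 0 : V].
Proof.
split; first by split=> // a u v -> ->; rewrite scaler0 addr0.
move=> _ a ->; split=> /=;
  by rewrite ?(linear_0 (lprec_linearl _)) ?(linear_0 (lprec_linearr _))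
    ?(linear_0 (lsucc_linearl _)) ?(linear_0 (lsucc_linearr _)).
Qed.

Lemma maximal_ideal (k : fieldType) (V : lAlgebraType k) (K : set V) (u : V) :
  lalg_ideal K -> ~ K u ->
  exists J, [/\ K `<=` J, lalg_ideal J, ~ J u &
    forall J', J `<=` J' -> lalg_ideal J' -> ~ J' u -> J' = J].
Proof.
move=> iK nKu.
have [|F [X0 FX0] sF tF|J [KJ [iJ nJu] Jmax]] :=
    @Zorn_above _ [set J | lalg_ideal J /\ ~ J u] K.
- by [].
- split; last by move=> [X FX Xu]; have [_ +] := sF _ FX; apply.
  split.
    split; first by exists X0 => //; have [[[+ _] _] _] := sF _ FX0.
    move=> a x y [X FX Xx] [Y FY Yy]; case: (tF _ _ FX FY) => sXY.
    + by exists Y => //; have [[[_ +] _] _] := sF _ FY; apply; [exact: sXY|].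
    + by exists X => //; have [[[_ +] _] _] := sF _ FX; apply; [|exact: sXY].
  move=> x a [X FX Xx]; have [[_ mX] _] := sF _ FX; have [h1 h2 h3 h4] := mX x a Xx.
  by split; exists X.
- by exists J; split=> // J' JJ' iJ' nJ'u; exact: Jmax.
Qed.

Theorem theorem5p11 (k : fieldType) (A B C : lAlgebraType k)
    (P : lAlgebraType k) (e1 : B -> P) (e2 : C -> P)
    (hP : is_free_product e1 e2)
    (hB : exists b : B, b != 0) (hC : exists c : C, c != 0)
    (hk : card_le_dim k P)
    (hA : [set: A] #<= [set: P]) :
  exists (S : lAlgebraType k) (iA : A -> S) (iB : B -> S) (iC : C -> S),
    [/\ lalg_embedding iA, lalg_embedding iB, lalg_embedding iC,
        lalg_simple S &
        lalg_generated (range iB `|` range iC) = [set: S]].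
Proof.
have [XA hXA] := hamel_exists A; have [XB hXB] := hamel_exists B.
have [XC hXC] := hamel_exists C.
have [b0 _] := basis_inhabited hXB hB; have [c0 _] := basis_inhabited hXC hC.
have [word word_inj] := index_words hP hXB hXC b0 c0 hk hA.
have c0_neq0 := basis_neq0 c0 hXC.
pose N : lmodType k := (A * B * (seq (set_type XB + set_type XC) -> C))%type.
pose iota (x : A + B + C) : N :=
  match x with
  | inl (inl a) => @inA k A B C XB XC a
  | inl (inr b) => @inB k A B C XB XC b
  | inr c => @inC k A B C XB XC c
  end.
have /choice[dual dualP] : forall n : N, exists f : N -> k^o, linear f /\ (n != 0 -> f n = 1).
  move=> n; have [->|n0] := eqVneq n 0; last by have [f [lf f1]] := nonzero_functional n0; exists f.
  by exists (fun=> 0); split; [move=> a x y; rewrite scaler0 addr0|].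
(* The index (true, x) is to send x to u if x is nonzero, and (false, x) to send
   u to x. *)
pose u : N := @inB k A B C XB XC (val b0).
pose phi (i : bool * (A + B + C)) : N -> k^o := dual (if i.1 then iota i.2 else u).
pose tgt (i : bool * (A + B + C)) : N := if i.1 then u else iota i.2.
have phi_linear i : linear (phi i) by exact: (dualP _).1.
have [L [F [m [[F_lin F_inj] [homA homB homC] m_gen mE]]]] :=
  word_envelope hXA hXB hXC b0 c0_neq0 word_inj tgt phi_linear.
have mu x : iota x != 0 -> m (true, x) ≻ (F (iota x) ≺ m (true, x)) = F u.
  by move=> x0; rewrite mE /phi /= (dualP _).2 // scale1r.
have u_neq0 : u != 0.
  apply/eqP => /(congr1 (fun n : N => n.1.2)) b00.
  by move/negP: (basis_neq0 b0 hXB); apply; apply/eqP.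
have mu' x : m (false, x) ≻ (F u ≺ m (false, x)) = F (iota x).
  by rewrite mE /phi /= (dualP _).2 // scale1r.
have [h1 h2 hU] := hP.
have [f [hf fe1 fe2 _]] := hU _ _ _ homB homC.
have [lf fp fs] := hf.
have fm i : exists p, f p = m i.
  have [] : range f (m i); last by move=> p _ <-; exists p.
  apply: m_gen; first exact: hom_range.
  - by move=> b; exists (e1 b) => //; exact: fe1.
  - by move=> c; exists (e2 c) => //; exact: fe2.
pose w := e1 (val b0).
have fw : f w = F u by exact: fe1.
have fiota x : exists p, f p = F (iota x).
  by have [p fpm] := fm (false, x); exists (p ≻ (w ≺ p)); rewrite fs fp fpm fw mu'.
pose K : set P := f @^-1` [set 0].
have iK : lalg_ideal K by apply: hom_preimage_ideal => //; exact: ideal0.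
(* An element of P with the same image in L as an element of J differs from it by
   an element of ker f, hence lies in J. *)
have hitting (J : set P) : lalg_ideal J -> K `<=` J ->
    forall p q q', J p -> f (q ≻ (p ≺ q)) = f q' -> J q'.
  move=> [sJ mJ] KJ p q q' Jp fE.
  have Jqp : J (q ≻ (p ≺ q)).
    by have [_ h _ _] := mJ p q Jp; have [_ _ h' _] := mJ _ q h.
  rewrite -[q'](subrK (q ≻ (p ≺ q))); apply: subspaceD => //; apply: KJ.
  by rewrite /K /preimage /= linear_sub // fE subrr.
have to_w (J : set P) : lalg_ideal J -> K `<=` J ->
    forall p x, J p -> f p = F (iota x) -> iota x != 0 -> J w.
  move=> iJ KJ p x Jp fpx x0; have [q fq] := fm (true, x).
  by apply: (hitting J iJ KJ p q w Jp); rewrite fs fp fq fpx mu.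
have from_w (J : set P) : lalg_ideal J -> K `<=` J -> J w -> J = [set: P].
  move=> iJ KJ Jw; apply: (free_product_ind hP); first exact: ideal_subalgebra.
  - move=> b; have [q fq] := fm (false, inl (inr b)).
    apply: (hitting J iJ KJ w q _ Jw); rewrite fs fp fq fw mu'; exact: esym (fe1 b).
  - move=> c; have [q fq] := fm (false, inr c).
    apply: (hitting J iJ KJ w q _ Jw); rewrite fs fp fq fw mu'; exact: esym (fe2 c).
have nKw : ~ K w.
  rewrite /K /preimage /= fw -(linear_0 F_lin) => /F_inj; exact/eqP.
have [J [KJ iJ nJw Jmax]] := maximal_ideal iK nKw.
have [S [pi [hpi pi_surj piJ]]] := quotient_type iJ.
have [lpi pp ps] := hpi.
have /choice[g gE] := fiota.
have pig p q : f p = f q -> pi p = pi q.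
  move=> fpq; apply/eqP; rewrite -subr_eq0 -linear_sub //; apply/eqP/piJ/KJ.
  by rewrite /K /preimage /= linear_sub // fpq subrr.
(* A nonzero element sent to zero would bring w into J. *)
have emb (E : lAlgebraType k) (e : E -> A + B + C) (h : E -> P) :
    (forall x, f (h x) = F (iota (e x))) -> lalg_hom (F \o iota \o e) ->
    injective (iota \o e) -> lalg_embedding (pi \o h).
  move=> hE [le ep es] ie.
  have hlin : linear (pi \o h).
    move=> a x y; rewrite /= -lpi; apply: pig; rewrite lf !hE; exact: le.
  split; first split=> // x y.
  - by rewrite /= -pp; apply: pig; rewrite fp !hE; exact: ep.
  - by rewrite /= -ps; apply: pig; rewrite fs !hE; exact: es.
  move=> x y hxy; apply/eqP; rewrite -subr_eq0; apply/eqP; apply: contrapT => xy0.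
  apply: nJw; apply: (to_w J iJ KJ (h (x - y)) (e (x - y))) => //.
    by apply/piJ; rewrite -[LHS]/((pi \o h) _) linear_sub // hxy subrr.
  apply/eqP => exy0; apply: xy0; apply: ie => /=; rewrite exy0; apply: F_inj.
  rewrite linear_0 //; apply: esym; exact: (linear_0 le).
exists S, (pi \o (g \o (inl \o inl))), (pi \o e1), (pi \o e2).
have inA_inj : injective (iota \o (inl \o inl)) by move=> x y /(congr1 (fun n : N => n.1.1)).
have inB_inj : injective (iota \o (inl \o inr)) by move=> x y /(congr1 (fun n : N => n.1.2)).
have inC_inj : injective (iota \o inr) by move=> x y /(congr1 (fun n : N => n.2 [::])).
split.
- by apply: (emb _ (inl \o inl)) => // x; exact: gE.
- by apply: (emb _ (inl \o inr)) => // x; exact: fe1.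
- by apply: (emb _ inr) => // x; exact: fe2.
- move=> I iI; have iI' := hom_preimage_ideal hpi iI.
  have JI : J `<=` pi @^-1` I.
    by move=> p /piJ pi0; rewrite /preimage /= pi0; case: iI => -[].
  have [Iw|nIw] := pselect ((pi @^-1` I) w).
    right; have IT := from_w _ iI' (subset_trans KJ JI) Iw.
    apply/seteqP; split=> // s _.
    have [p _ <-] : range pi s by rewrite pi_surj.
    by rewrite -[I _]/((pi @^-1` I) p) IT.
  left; have IJ := Jmax _ JI iI' nIw.
  apply/seteqP; split=> s; last by move=> ->; case: iI => -[].
  have [p _ <-] : range pi s by rewrite pi_surj.
  by rewrite -[I _]/((pi @^-1` I) p) IJ => /piJ.
- apply/seteqP; split=> // s _; have [p _ <-] : range pi s by rewrite pi_surj.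
  move=> D [subD sD].
  suff DT : pi @^-1` D = [set: P] by rewrite -[D _]/((pi @^-1` D) p) DT.
  apply: (free_product_ind hP); first exact: hom_preimage_subalgebra.
  + by move=> b; apply: sD; left; exists b.
  + by move=> c; apply: sD; right; exists c.
Qed.
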